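(* A (part of) the sphere $S^2(\frac{1}{\sqrt2})$ in $S^3$ is proper biharmonic. Furthermore, the isometric immersion can be locally expressed as $$\varphi:\Big(S^2(\tfrac{1}{\sqrt2}),\tfrac{4(dx^2+dy^2)}{(2+x^2+y^2)^2}\Big)\to\Big(S^3,\tfrac{4(dx^2+dy^2+dz^2)}{(1+x^2+y^2+z^2)^2}\Big),\qquad \varphi(x,y)=(x,y,1).$$
   Context: $S^2(\frac{1}{\sqrt2})$ is the round 2-sphere of radius $\frac1{\sqrt2}$ and $S^3$ the unit 3-sphere; the displayed metrics are their expressions in local coordinates $(x,y)\in\mathbb{R}^2$, $(x,y,z)\in\mathbb{R}^3$ on the spheres minus a point. A submanifold is called (proper) biharmonic if the isometric immersion defining it is a (proper) biharmonic map. A map $\varphi:(M,g)\to(N,h)$ is harmonic if $\tau(\varphi)=\mathrm{Trace}_g\nabla d\varphi=0$, biharmonic if $\tau_2(\varphi)=\mathrm{Trace}_g(\nabla^\varphi\nabla^\varphi-\nabla^\varphi_{\nabla^M})\tau(\varphi)-\mathrm{Trace}_g R^N(d\varphi,\tau(\varphi))d\varphi=0$ with $R^N(X,Y)Z=[\nabla^N_X,\nabla^N_Y]Z-\nabla^N_{[X,Y]}Z$, and proper biharmonic if biharmonic but not harmonic. *)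

(* Defs.v *)
From HB Require Import structures.
From mathcomp Require Import all_boot all_order all_algebra.
From mathcomp Require Import all_classical all_reals all_analysis.

Set Implicit Arguments.
Unset Strict Implicit.
Unset Printing Implicit Defensive.

Import Order.TTheory GRing.Theory Num.Theory.
Import numFieldNormedType.Exports.

Local Open Scope classical_set_scope.
Local Open Scope ring_scope.

Section Calculus.
Variables (R : realType) (n : nat).

Definition partial (i : 'I_n) (f : 'rV[R]_n -> R) : 'rV[R]_n -> R :=
  'D_(delta_mx 0 i) f.

(* C^oo on an open set U: partial derivatives of all orders exist and are
   (Frechet) differentiable on U. *)
Definition smooth_on (U : set 'rV[R]_n) (f : 'rV[R]_n -> R) : Prop :=
  forall (s : seq 'I_n) (x : 'rV[R]_n), U x -> differentiable (foldr partial f s) x.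

Definition normsq (v : 'rV[R]_n) : R := \sum_(i < n) v 0 i ^+ 2.

End Calculus.

(* Riemannian geometry of a metric g on (an open subset of) R^n, given by its
   matrix of coefficients g x i j = g_x(d_i, d_j). *)
Section LeviCivita.
Variables (R : realType) (n : nat) (g : 'rV[R]_n -> 'M[R]_n).

(* Gamma^k_ij *)
Definition christoffel (k i j : 'I_n) (x : 'rV[R]_n) : R :=
  2^-1 * \sum_(l < n) invmx (g x) k l *
    (partial i (fun y => g y j l) x + partial j (fun y => g y i l) x
     - partial l (fun y => g y i j) x).

Definition nabla (X Y : 'rV[R]_n -> 'rV[R]_n) (x : 'rV[R]_n) : 'rV[R]_n :=
  \row_(k < n) (\sum_(i < n) X x 0 i * partial i (fun y => Y y 0 k) x
    + \sum_(i < n) \sum_(j < n) christoffel k i j x * X x 0 i * Y x 0 j).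

Definition lie_bracket (X Y : 'rV[R]_n -> 'rV[R]_n) (x : 'rV[R]_n) : 'rV[R]_n :=
  \row_(k < n) \sum_(i < n) (X x 0 i * partial i (fun y => Y y 0 k) x
    - Y x 0 i * partial i (fun y => X y 0 k) x).

Definition curvature (X Y Z : 'rV[R]_n -> 'rV[R]_n) (x : 'rV[R]_n) : 'rV[R]_n :=
  nabla X (nabla Y Z) x - nabla Y (nabla X Z) x - nabla (lie_bracket X Y) Z x.

(* The curvature is a tensor, so its value on tangent vectors u, v, w at x is
   computed from any extensions to vector fields; we take the constant ones. *)
Definition curvature_at (x u v w : 'rV[R]_n) : 'rV[R]_n :=
  curvature (fun=> u) (fun=> v) (fun=> w) x.

End LeviCivita.

Section Maps.
Variables (R : realType) (m n : nat).
Variables (g : 'rV[R]_m -> 'M[R]_m) (h : 'rV[R]_n -> 'M[R]_n).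
Variable f : 'rV[R]_m -> 'rV[R]_n.

(* df(d_i), a vector field along f *)
Definition dmap (i : 'I_m) (x : 'rV[R]_m) : 'rV[R]_n :=
  \row_(a < n) partial i (fun y => f y 0 a) x.

Definition pullback_metric (x : 'rV[R]_m) : 'M[R]_m :=
  \matrix_(i < m, j < m) (dmap i x *m h (f x) *m (dmap j x)^T) 0 0.

(* nabla^f_(d_i) V, for V a vector field along f *)
Definition nabla_along (i : 'I_m) (V : 'rV[R]_m -> 'rV[R]_n) (x : 'rV[R]_m) :
    'rV[R]_n :=
  \row_(a < n) (partial i (fun y => V y 0 a) x
    + \sum_(b < n) \sum_(c < n)
        christoffel h a b c (f x) * dmap i x 0 b * V x 0 c).

(* (nabla df)(d_i, d_j) *)
Definition hess_map (i j : 'I_m) (x : 'rV[R]_m) : 'rV[R]_n :=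
  nabla_along i (dmap j) x - \sum_(k < m) christoffel g k i j x *: dmap k x.

Definition tension (x : 'rV[R]_m) : 'rV[R]_n :=
  \sum_(i < m) \sum_(j < m) invmx (g x) i j *: hess_map i j x.

Definition bitension (x : 'rV[R]_m) : 'rV[R]_n :=
  \sum_(i < m) \sum_(j < m) invmx (g x) i j *:
     (nabla_along i (nabla_along j tension) x
      - \sum_(k < m) christoffel g k i j x *: nabla_along k tension x)
  - \sum_(i < m) \sum_(j < m) invmx (g x) i j *:
     curvature_at h (f x) (dmap i x) (tension x) (dmap j x).

End Maps.

(* A chart, with image all of R^n, of an n-dimensional submanifold of R^a:
   [coord] is meaningful on [chart_dom] and [param] is its inverse. *)
Record chart (R : realType) (a n : nat) := Chart {
  chart_dom : set 'rV[R]_a;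
  coord : 'rV[R]_a -> 'rV[R]_n;
  param : 'rV[R]_n -> 'rV[R]_a }.

(* The metric induced by the Euclidean one, in the coordinates of the chart. *)
Definition chart_metric (R : realType) (a n : nat) (c : chart R a n) :
    'rV[R]_n -> 'M[R]_n :=
  pullback_metric (fun=> 1%:M) (param c).

(* Submanifolds of Euclidean spaces are given by atlases MM and NN (sets of
   charts) and carry the induced metrics; P is an open part of the source and
   F a map from P to the target. *)
Section MapsOfSubmanifolds.
Variables (R : realType) (a m b n : nat).
Variables (MM : set (chart R a m)) (NN : set (chart R b n)).
Variables (P : set 'rV[R]_a) (F : 'rV[R]_a -> 'rV[R]_b).

Definition local_expr (c : chart R a m) (d : chart R b n) :
    'rV[R]_m -> 'rV[R]_n :=
  fun x => coord d (F (param c x)).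

Definition local_dom (c : chart R a m) (d : chart R b n) : set 'rV[R]_m :=
  [set x | P (param c x) /\ chart_dom d (F (param c x))].

Definition smooth_map : Prop :=
  (forall p, P p -> exists2 d, NN d & chart_dom d (F p)) /\
  (forall c d, MM c -> NN d -> forall k : 'I_n,
     smooth_on (local_dom c d) (fun x => local_expr c d x 0 k)).

(* The last condition forces the differential of F to be injective, the
   induced metrics being positive definite. *)
Definition isometric_immersion : Prop :=
  smooth_map /\
  (forall c d, MM c -> NN d -> forall x, local_dom c d x ->
     pullback_metric (chart_metric d) (local_expr c d) x = chart_metric c x).

Definition harmonic : Prop :=
  smooth_map /\
  (forall c d, MM c -> NN d -> forall x, local_dom c d x ->
     tension (chart_metric c) (chart_metric d) (local_expr c d) x = 0).

Definition biharmonic : Prop :=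
  smooth_map /\
  (forall c d, MM c -> NN d -> forall x, local_dom c d x ->
     bitension (chart_metric c) (chart_metric d) (local_expr c d) x = 0).

Definition proper_biharmonic : Prop := biharmonic /\ ~ harmonic.

End MapsOfSubmanifolds.

Definition orthogonal_mx (R : realType) (n : nat) (B : 'M[R]_n) : Prop :=
  B *m B^T = 1%:M.

Section Spheres.
Variables (R : realType) (n : nat) (r : R).

(* S^n(r) *)
Definition sphere : set 'rV[R]_(n + 1) := [set p | normsq p = r ^+ 2].

(* Stereographic projection of S^n(r) in the orthonormal frame formed by the
   rows of B: from the pole r e, with e the last row of B, onto the hyperplane
   orthogonal to e at distance l from that pole on the side of the sphere
   (l = r: equatorial; l = 2 r: tangent at the antipode). *)
Definition stereo (l : R) (B : 'M[R]_(n + 1)) : chart R (n + 1) n :=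
  {| chart_dom :=
       [set p | sphere p /\ rsubmx (p *m B^T) 0 0 != r];
     coord := fun p =>
       (l / (r - rsubmx (p *m B^T) 0 0)) *: lsubmx (p *m B^T);
     param := fun y =>
       (r / (l ^+ 2 + normsq y)) *:
         (row_mx ((2 * l) *: y) (normsq y - l ^+ 2)%:M *m B) |}.

(* These charts are pairwise smoothly compatible and cover the sphere. *)
Definition sphere_atlas : set (chart R (n + 1) n) :=
  [set c | exists l B, [/\ 0 < l, orthogonal_mx B & c = stereo l B]].

End Spheres.

Arguments sphere {R} n r _.
Arguments sphere_atlas {R} n r _.

(* The inclusion of S^2(1/sqrt 2) in S^3 as the small sphere
   {p in S^3 | <p, e> = 1/sqrt 2}, with e the last row of the orthogonal
   matrix A. *)
Definition small_sphere (R : realType) (A : 'M[R]_(3 + 1)) (p : 'rV[R]_(2 + 1)) :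
    'rV[R]_(3 + 1) :=
  row_mx p ((Num.sqrt 2)^-1)%:M *m A.

(* Main.v *)
Require Import Defs.
From HB Require Import structures.
From mathcomp Require Import all_boot all_order all_algebra.
From mathcomp Require Import all_classical all_reals all_analysis.
From mathcomp Require Import ring.
Import Order.TTheory GRing.Theory Num.Theory.
Import numFieldNormedType.Exports.
Local Open Scope classical_set_scope.
Local Open Scope ring_scope.

(** A stereographic parametrization [Phi] of a sphere of radius [r] in flat
    space turns intrinsic computations into extrinsic ones: if [J] is its
    Jacobian, then [V |-> V *m J] identifies fields along a map with tangent
    fields of the sphere, and covariant derivatives become flat derivatives
    corrected by a multiple of the position vector (Gauss formula).

    Write [P] for the position on [S^2(1/sqrt 2)] and [phi = (P, r) A] for its
    image in [S^3]. Extrinsically the second fundamental form is [g_ij eta]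
    with [eta = (-P, r) A] the unit normal, so the tension field [tau] is
    [2 eta], and its covariant derivative along [d_j] is [-2 d_j phi]. Hence
    the rough Laplacian of [tau] is [-2 tau], which cancels the curvature term
    because [S^3] has constant curvature 1 and [tau] is orthogonal to the
    surface. *)

Set Implicit Arguments.
Unset Strict Implicit.
Unset Printing Implicit Defensive.

(** * The Euclidean dot product of row vectors *)

Section DotProduct.
Variables (R : comPzRingType) (n : nat).
Implicit Types (v w x : 'rV[R]_n) (k : R).

Definition dot v w : R := (v *m w^T) 0 0.

Lemma dotE v w : dot v w = \sum_i v 0 i * w 0 i.
Proof. by rewrite /dot mxE; apply: eq_bigr => i _; rewrite mxE. Qed.

Lemma dot_mx v w : v *m w^T = (dot v w)%:M.
Proof. by rewrite [LHS]mx11_scalar. Qed.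

Lemma dotC v w : dot v w = dot w v.
Proof. by rewrite !dotE; apply: eq_bigr => i _; rewrite mulrC. Qed.

Lemma dotDl v w x : dot (v + w) x = dot v x + dot w x.
Proof. by rewrite /dot mulmxDl mxE. Qed.

Lemma dotZl k v w : dot (k *: v) w = k * dot v w.
Proof. by rewrite /dot -scalemxAl mxE. Qed.

Lemma dotNl v w : dot (- v) w = - dot v w.
Proof. by rewrite /dot mulNmx mxE. Qed.

Lemma dotDr v w x : dot x (v + w) = dot x v + dot x w.
Proof. by rewrite dotC dotDl !(dotC x). Qed.

Lemma dotZr k v w : dot w (k *: v) = k * dot w v.
Proof. by rewrite dotC dotZl dotC. Qed.

Lemma dotNr v w : dot w (- v) = - dot w v.
Proof. by rewrite dotC dotNl dotC. Qed.

Lemma dot0l v : dot 0 v = 0.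
Proof. by rewrite /dot mul0mx mxE. Qed.

Lemma dot_delta v i : dot v (delta_mx 0 i) = v 0 i.
Proof.
rewrite dotE (bigD1 i)//= big1 => [|j ji]; rewrite mxE ?eqxx ?mulr1 ?addr0//.
by rewrite (negbTE ji) andbF mulr0.
Qed.

Definition dotDE := (dotDl, dotDr, dotZl, dotZr, dotNl, dotNr).

End DotProduct.

Lemma normsqE (R : realType) n (v : 'rV[R]_n) : normsq v = dot v v.
Proof. by rewrite dotE; apply: eq_bigr => i _; rewrite expr2. Qed.

Lemma normsq_ge0 (R : realType) n (v : 'rV[R]_n) : 0 <= normsq v.
Proof. by apply: sumr_ge0 => i _; exact: sqr_ge0. Qed.

Lemma dot_row_mx (R : comPzRingType) n1 n2 (v1 w1 : 'rV[R]_n1) (v2 w2 : 'rV[R]_n2) :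
  dot (row_mx v1 v2) (row_mx w1 w2) = dot v1 w1 + dot v2 w2.
Proof. by rewrite /dot tr_row_mx mul_row_col mxE. Qed.

Lemma dot_scalar (R : comPzRingType) (k k' : R) : dot k%:M k'%:M = k * k'.
Proof. by rewrite dotE big_ord1 !mxE eqxx !mulr1n. Qed.

Lemma dot_mulmx (R : comPzRingType) n p (M : 'M[R]_(n, p)) (v w : 'rV[R]_n) k :
  M *m M^T = k%:M -> dot (v *m M) (w *m M) = k * dot v w.
Proof.
by move=> MM; rewrite /dot trmx_mul mulmxA -(mulmxA v) MM mul_mx_scalar -scalemxAl mxE.
Qed.

(** * Partial derivatives of vector-valued maps *)

Section VectorDerivative.
Variables (R : realType) (m : nat).

(** Records that the derivative exists along with its value: a value of [dmap] alone carries no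
    differentiability, which the product rule needs. *)
Definition is_partial n (i : 'I_m) (F : 'rV[R]_m -> 'rV[R]_n) x (dF : 'rV[R]_n) :=
  forall a, is_derive x (delta_mx 0 i) (fun y => F y 0 a) (dF 0 a).

Lemma is_partial_dmap n i (F : 'rV[R]_m -> 'rV[R]_n) x dF :
  is_partial i F x dF -> dmap F i x = dF.
Proof.
by move=> FdF; apply/rowP => a; rewrite mxE; have [_ <-] := FdF a.
Qed.

Lemma near_eq_dmap n i (F G : 'rV[R]_m -> 'rV[R]_n) x :
  (\near x, F x = G x) -> dmap F i x = dmap G i x.
Proof.
move=> FG; apply/rowP => a; rewrite !mxE; apply: near_eq_derive.
by apply: filterS FG => y ->.
Qed.

Lemma eq_is_partial n i (F G : 'rV[R]_m -> 'rV[R]_n) x dF dG :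
  is_partial i F x dF -> F =1 G -> dF = dG -> is_partial i G x dG.
Proof. by move=> + /funext FG dFG; rewrite FG dFG. Qed.

Lemma is_partial_cst n i (v : 'rV[R]_n) x : is_partial i (fun=> v) x 0.
Proof. by move=> a; rewrite mxE; exact: is_derive_cst. Qed.

Lemma is_partial_id i x : is_partial i id x (delta_mx 0 i).
Proof.
move=> a; have h := @differentiable_coord R 1 m x 0 a.
apply: DeriveDef; first exact: diff_derivable.
rewrite deriveE//.
(* The coordinate function is packaged as a linear map; being continuous, it is its own
   differential. *)
have @f : {linear 'rV[R]_m -> R}.
  by exists (fun N : 'rV[R]_m => N 0 a); do 2![eexists]; do ?[constructor];
     rewrite ?mxE// => ? *; rewrite ?mxE//; move=> ?; rewrite !mxE.
rewrite (_ : (fun y => _) = f) // diff_lin//.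
exact: coord_continuous.
Qed.

Lemma is_partialD n i (F G : 'rV[R]_m -> 'rV[R]_n) x dF dG :
  is_partial i F x dF -> is_partial i G x dG ->
  is_partial i (fun y => F y + G y) x (dF + dG).
Proof.
move=> hF hG a; rewrite mxE; under [X in is_derive _ _ X _]funext do rewrite mxE.
exact: is_deriveD.
Qed.

Lemma is_partialZ n i (u : 'rV[R]_m -> R) (F : 'rV[R]_m -> 'rV[R]_n) x du dF :
  is_derive x (delta_mx 0 i) u du -> is_partial i F x dF ->
  is_partial i (fun y => u y *: F y) x (du *: F x + u x *: dF).
Proof.
move=> hu hF a; under [X in is_derive _ _ X _]funext do rewrite mxE.
by rewrite !mxE addrC (mulrC du); exact: (is_deriveM hu (hF a)).
Qed.

Lemma is_derive_bigsum n x v (h : 'I_n -> 'rV[R]_m -> R) (dh : 'I_n -> R) :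
  (forall i, is_derive x v (h i) (dh i)) ->
  is_derive x v (fun y => \sum_i h i y) (\sum_i dh i).
Proof.
by move=> /is_derive_sum; congr (is_derive _ _ _ _); apply/funext => y; rewrite fct_sumE.
Qed.

Lemma is_partial_mulmx n p i (F : 'rV[R]_m -> 'rV[R]_n) (M : 'M[R]_(n, p)) x dF :
  is_partial i F x dF -> is_partial i (fun y => F y *m M) x (dF *m M).
Proof.
move=> hF a; under [X in is_derive _ _ X _]funext do rewrite mxE.
rewrite mxE; apply: is_derive_bigsum => j.
rewrite mulrC; have := is_deriveZ (M j a) (hF j).
by congr (is_derive _ _ _ _); apply/funext => y; exact: mulrC.
Qed.

Lemma is_derive_dot n i (F G : 'rV[R]_m -> 'rV[R]_n) x dF dG :
  is_partial i F x dF -> is_partial i G x dG ->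
  is_derive x (delta_mx 0 i) (fun y => dot (F y) (G y)) (dot dF (G x) + dot (F x) dG).
Proof.
move=> hF hG; under [X in is_derive _ _ X _]funext do rewrite dotE.
rewrite !dotE -big_split; apply: is_derive_bigsum => a.
rewrite /= addrC (mulrC (dF 0 a)); exact: (is_deriveM (hF a) (hG a)).
Qed.

End VectorDerivative.

(** * Extrinsic geometry of a sphere in a stereographic chart *)

Section Stereographic.
Variables (R : realType) (n : nat) (r l : R) (B : 'M[R]_(n + 1)).
Hypotheses (r0 : 0 < r) (l0 : 0 < l) (hB : orthogonal_mx B).
Implicit Types (y v w : 'rV[R]_n).

(* [param] equals [r *: dsubmx B + (2 * l * r * weight) *: ray], with [weight]
   scalar and [ray] affine; [jac] is its Jacobian and [christ y v w] the
   contraction of the Christoffel symbols with [v] and [w]. [ray] is locked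
   lest the linearity lemmas on [dot] unfold it. *)
Definition weight y : R := (l ^+ 2 + normsq y)^-1.

Definition ray y : 'rV[R]_(n + 1) := locked (y *m usubmx B - l *: dsubmx B).

Lemma rayE y : ray y = y *m usubmx B - l *: dsubmx B.
Proof. by rewrite /ray -lock. Qed.

Definition jac y : 'M[R]_(n, n + 1) :=
  (2 * l * r * weight y) *: (usubmx B - (2 * weight y) *: (y^T *m ray y)).

Definition christ y v w : 'rV[R]_n :=
  (- 2 * weight y) *: (dot y v *: w + dot y w *: v - dot v w *: y).

Local Notation Phi := (param (stereo r l B)).

Lemma weight_gt0 y : 0 < weight y.
Proof. by rewrite invr_gt0 ltr_pwDl ?normsq_ge0// exprn_gt0. Qed.

Lemma weight_neq0 y : weight y != 0.
Proof. by rewrite gt_eqF// weight_gt0. Qed.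

Lemma dotyy y : dot y y = (weight y)^-1 - l ^+ 2.
Proof. by rewrite invrK normsqE addrC addKr. Qed.

(** Geometrically, a point of the sphere is the pole [r *: dsubmx B] plus a multiple of [ray y], the
    vector from the pole to the projected point. *)
Lemma paramE y : Phi y = r *: dsubmx B + (2 * l * r * weight y) *: ray y.
Proof.
rewrite /= -[in LHS](vsubmxK B) mul_row_col mul_scalar_mx -scalemxAl rayE.
have := dotyy y; rewrite -normsqE -/(weight y); have := weight_neq0 y.
rewrite -/(weight y); move: (weight y) (normsq y) => u q u0 ->.
by apply/rowP => a; rewrite !mxE; field.
Qed.

Lemma mul_jac v y :
  v *m jac y =
    (2 * l * r * weight y) *: (v *m usubmx B - (2 * weight y * dot v y) *: ray y).
Proof.
rewrite /jac -scalemxAr mulmxBr -scalemxAr mulmxA dot_mx mul_scalar_mx.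
by rewrite scalerA.
Qed.

(** The rows of [B] are orthonormal. The products of [ray], [usubmx B] and [dsubmx B] that follow
    are special cases. *)
Lemma dot_frame v w (k k' : R) :
  dot (v *m usubmx B + k *: dsubmx B) (w *m usubmx B + k' *: dsubmx B)
  = dot v w + k * k'.
Proof.
have mulB (x : 'rV_n) (a : R) : x *m usubmx B + a *: dsubmx B = row_mx x a%:M *m B.
  by rewrite -[in RHS](vsubmxK B) mul_row_col mul_scalar_mx.
by rewrite !mulB (@dot_mulmx _ _ _ _ _ _ 1)// mul1r dot_row_mx dot_scalar.
Qed.

Lemma dot_usub v w : dot (v *m usubmx B) (w *m usubmx B) = dot v w.
Proof. by have := dot_frame v w 0 0; rewrite !scale0r !addr0 mulr0 addr0. Qed.

Lemma dot_ray_usub y v : dot (ray y) (v *m usubmx B) = dot y v.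
Proof.
by have := dot_frame y v (- l) 0; rewrite scale0r addr0 mulr0 addr0 scaleNr -rayE.
Qed.

Lemma dot_usub_dsub v : dot (v *m usubmx B) (dsubmx B) = 0.
Proof.
have := dot_frame v 0 0 1.
by rewrite scale0r addr0 mul0mx add0r scale1r mul0r addr0 (dotC v) dot0l => ->.
Qed.

Lemma dot_dsub : dot (dsubmx B) (dsubmx B) = 1.
Proof.
have := dot_frame 0 0 1 1.
by rewrite mul0mx add0r scale1r mul1r dot0l add0r => ->.
Qed.

Lemma dot_ray y : dot (ray y) (ray y) = (weight y)^-1.
Proof.
have := dot_frame y y (- l) (- l); rewrite scaleNr -rayE => ->.
by rewrite dotyy; ring.
Qed.

Lemma dot_ray_dsub y : dot (ray y) (dsubmx B) = - l.
Proof. by rewrite rayE !dotDE dot_usub_dsub dot_dsub; ring. Qed.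

(** Up to the factor [2 * l * r * weight y], [v *m jac y] is the image of [v *m usubmx B] under the
    reflection in the hyperplane orthogonal to [ray y], because [ray y] has squared length
    [(weight y)^-1]. Hence the chart is conformal. *)
Lemma dot_jac v w y :
  dot (v *m jac y) (w *m jac y) = (2 * l * r * weight y) ^+ 2 * dot v w.
Proof.
rewrite !mul_jac !dotDE dot_usub dot_ray (dotC _ (ray y)) !dot_ray_usub.
rewrite !(dotC y); move: (dot v y) (dot w y) => a b.
by field; exact: weight_neq0.
Qed.

Lemma dot_jac_param v y : dot (v *m jac y) (Phi y) = 0.
Proof.
rewrite mul_jac paramE !dotDE dot_usub_dsub dot_ray dot_ray_dsub.
rewrite (dotC _ (ray y)) !dot_ray_usub (dotC y).
by field; exact: weight_neq0.
Qed.

Lemma dot_param y : dot (Phi y) (Phi y) = r ^+ 2.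
Proof.
rewrite paramE !dotDE dot_dsub (dotC _ (ray y)) dot_ray dot_ray_dsub.
by field; exact: weight_neq0.
Qed.

(** A conformal map with nonzero factor is injective. Identities between fields along a map can thus
    be checked in the flat ambient space. *)
Lemma jac_inj v w y : v *m jac y = w *m jac y -> v = w.
Proof.
move=> vw; apply/rowP => a; apply/eqP; rewrite -subr_eq0; apply/eqP.
have /eqP := dot_jac (v - w) (delta_mx 0 a) y.
rewrite mulmxBl vw subrr dot0l eq_sym mulf_eq0 dot_delta sqrf_eq0 !mulf_eq0.
rewrite (gt_eqF l0) (gt_eqF r0) (negbTE (weight_neq0 y)) pnatr_eq0/=.
by rewrite !mxE => /eqP.
Qed.

(** * Flat derivatives along a map into the chart *)

Section Along.
Variables (m : nat) (i : 'I_m) (x : 'rV[R]_m) (f : 'rV[R]_m -> 'rV[R]_n) (df : 'rV[R]_n).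
Hypothesis hf : is_partial i f x df.

Lemma is_derive_weight :
  is_derive x (delta_mx 0 i) (fun z => weight (f z))
    (- 2 * weight (f x) ^+ 2 * dot (f x) df).
Proof.
rewrite /weight; under [X in is_derive _ _ X _]funext do rewrite normsqE.
have hd : is_derive x (delta_mx 0 i) (fun z => l ^+ 2 + dot (f z) (f z))
   (0 + (dot df (f x) + dot (f x) df)).
  exact: (is_deriveD (is_derive_cst _ _ _) (is_derive_dot hf hf)).
have h0 : l ^+ 2 + dot (f x) (f x) != 0.
  by have := weight_neq0 (f x); rewrite invr_eq0 normsqE.
apply: DeriveDef; first exact: derivableV.
rewrite deriveV// derive_val normsqE -[_ *: _]/(_ * _).
by rewrite (dotC df) exprVn; ring.
Qed.

Lemma is_partial_ray :
  is_partial i (fun z => ray (f z)) x (df *m usubmx B).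
Proof.
apply: eq_is_partial (is_partialD (is_partial_mulmx (usubmx B) hf)
  (is_partial_cst i (- (l *: dsubmx B)) x)) _ _ => [z|]; last by rewrite addr0.
by rewrite rayE.
Qed.

Lemma is_partial_param : is_partial i (fun z => Phi (f z)) x (df *m jac (f x)).
Proof.
have hw : is_derive x (delta_mx 0 i) (fun z => 2 * l * r * weight (f z))
   (2 * l * r * (- 2 * weight (f x) ^+ 2 * dot (f x) df)).
  exact: (is_deriveZ (2 * l * r) is_derive_weight).
apply: eq_is_partial (is_partialD (is_partial_cst i (r *: dsubmx B) x)
  (is_partialZ hw is_partial_ray)) _ _ => [z|]; first by rewrite paramE.
rewrite add0r mul_jac (dotC df); move: (df *m usubmx B) (ray (f x)) => M z.
by apply/rowP => a; rewrite !mxE; ring.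
Qed.

(* Gauss formula: tangential part (the covariant derivative of [V] along [f])
   plus the component along the position vector. *)
Lemma is_partial_mul_jac (V : 'rV[R]_m -> 'rV[R]_n) dV :
  is_partial i V x dV ->
  is_partial i (fun z => V z *m jac (f z)) x
    ((dV + christ (f x) df (V x)) *m jac (f x)
     - (r ^- 2 * dot (df *m jac (f x)) (V x *m jac (f x))) *: Phi (f x)).
Proof.
move=> hV.
have hT (g : 'rV_m -> R) dg k : is_derive x (delta_mx 0 i) g dg ->
    is_derive x (delta_mx 0 i) (fun z => k * g z) (k * dg).
  exact: is_deriveZ.
have hw := hT _ _ (2 * l * r) is_derive_weight.
have h2 : is_derive x (delta_mx 0 i) (fun z => 2 * weight (f z) * dot (V z) (f z))
    (2 * weight (f x) * (dot dV (f x) + dot (V x) df)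
     + dot (V x) (f x) * (2 * (- 2 * weight (f x) ^+ 2 * dot (f x) df))).
  exact: (is_deriveM (hT _ _ 2 is_derive_weight) (is_derive_dot hV hf)).
have h3 := is_partialZ (hT _ _ (-1) h2) is_partial_ray.
apply: eq_is_partial (is_partialZ hw (is_partialD (is_partial_mulmx (usubmx B) hV) h3)) _ _.
  by move=> z; rewrite mul_jac -scaleNr mulN1r.
rewrite dot_jac paramE mul_jac mulmxDl.
(* The [f x] term of [christ] is expressed through [ray] and the pole direction, the two vectors in
   which [paramE] writes the position. *)
have fE : f x *m usubmx B = ray (f x) + l *: dsubmx B by rewrite rayE subrK.
rewrite {1}/christ -!scalemxAl !mulmxBl !mulmxDl -!scalemxAl fE.
rewrite !(dotC _ (f x)) (dotC (V x) df) !dotDE dotyy -!/(christ _ _ _).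
set u := weight (f x).
have u0 : u != 0 by exact: weight_neq0.
move: (df *m usubmx B) (V x *m usubmx B) (dV *m usubmx B) => dfB VB dVB.
move: (ray (f x)) (dsubmx B) => z e.
apply/rowP => a; rewrite !mxE.
by field; rewrite u0 gt_eqF.
Qed.
End Along.

(** * Metric, Christoffel symbols and curvature of the chart *)

Local Notation h := (chart_metric (stereo r l B)).

Lemma dmap_param i y : dmap Phi i y = delta_mx 0 i *m jac y.
Proof. exact/is_partial_dmap/(is_partial_param (is_partial_id i y)). Qed.

Lemma chart_metricE y : h y = ((2 * l * r * weight y) ^+ 2)%:M.
Proof.
apply/matrixP => i j; rewrite mxE mulmx1 -/(dot _ _) !dmap_param dot_jac.
by rewrite dot_delta !mxE eqxx eq_sym mulr_natr.
Qed.

Lemma partial_metric i j k y :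
  partial i (fun z => h z j k) y
  = (2 * l * r) ^+ 2 * (- 4 * weight y ^+ 3 * y 0 i) *+ (j == k).
Proof.
have hw := is_derive_weight (is_partial_id i y); rewrite /= dot_delta in hw.
have h2 := is_deriveZ ((2 * l * r) ^+ 2 *+ (j == k)) (is_deriveM hw hw).
have -> : (fun z => h z j k) = ((2 * l * r) ^+ 2 *+ (j == k)) *:
    ((fun z : 'rV[R]_n => weight z) * (fun z => weight z)).
  apply/funext => z; rewrite chart_metricE mxE -[RHS]/(_ * (_ * _)).
  by case: (j == k); rewrite ?mulr1n ?mulr0n ?mul0r// exprMn expr2.
rewrite /partial; have [_ ->] := h2; rewrite -![_ *: _]/(_ * _).
by case: (j == k); rewrite ?mulr1n ?mulr0n ?mul0r//; ring.
Qed.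

(** For a metric [exp (2 u)] times the flat one, the symbols are [delta_jk d_i u + delta_ik d_j u -
    delta_ij d_k u]. Here [u] is the logarithm of [weight] up to a constant, so
    [d_i u = - 2 * weight y * y_i]. *)
Lemma christoffel_stereo k i j y :
  christoffel h k i j y =
  - 2 * weight y * (y 0 i *+ (j == k) + y 0 j *+ (i == k) - y 0 k *+ (i == j)).
Proof.
rewrite /christoffel (bigD1 k)//= big1 => [|a ak]; last first.
  by rewrite chart_metricE invmx_scalar mxE eq_sym (negbTE ak) mul0r.
rewrite chart_metricE invmx_scalar mxE eqxx mulr1n !partial_metric addr0.
have u0 := weight_neq0 y; have l00 : l != 0 by rewrite gt_eqF.
have r00 : r != 0 by rewrite gt_eqF.
case: (j == k); case: (i == k); case: (i == j); rewrite ?mulr1n ?mulr0n;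
  by field; rewrite u0 l00 r00.
Qed.

Lemma christoffel_christ y v w :
  \row_k (\sum_(i < n) \sum_(j < n) christoffel h k i j y * v 0 i * w 0 j) = christ y v w.
Proof.
have sum_delta (F : 'I_n -> R) k : \sum_i F i *+ (i == k) = F k.
  by rewrite (bigD1 k)//= big1 => [|i /negbTE ->]; rewrite ?eqxx ?addr0.
apply/rowP => k; rewrite !mxE.
transitivity (- 2 * weight y * (\sum_i \sum_j (y 0 i * v 0 i * w 0 j *+ (j == k))
   + \sum_i \sum_j (v 0 i * (y 0 j * w 0 j)) *+ (i == k)
   - \sum_i \sum_j (y 0 k * v 0 i * w 0 j) *+ (j == i))).
  rewrite -big_split/= -sumrB mulr_sumr; apply: eq_bigr => i _.
  rewrite -big_split/= -sumrB mulr_sumr; apply: eq_bigr => j _.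
  rewrite christoffel_stereo (eq_sym j i).
  by case: (j == k); case: (i == k); case: (i == j); rewrite ?mulr1n ?mulr0n; ring.
congr (_ * (_ + _ - _)).
- by rewrite dotE mulr_suml; apply: eq_bigr => i _; rewrite sum_delta.
- under eq_bigr do rewrite sumrMnl -mulr_sumr; by rewrite sum_delta mulrC dotE.
- by rewrite dotE mulrC mulr_sumr; apply: eq_bigr => i _; rewrite sum_delta mulrA.
Qed.

Lemma nabla_stereo (X Y : 'rV[R]_n -> 'rV[R]_n) y :
  nabla h X Y y = \sum_i X y 0 i *: dmap Y i y + christ y (X y) (Y y).
Proof.
apply/rowP => k; rewrite -christoffel_christ mxE [RHS]mxE summxE mxE; congr (_ + _).
by apply: eq_bigr => i _; rewrite !mxE.
Qed.

Lemma nabla_cst (X : 'rV[R]_n -> 'rV[R]_n) v y :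
  nabla h X (fun=> v) y = christ y (X y) v.
Proof.
rewrite nabla_stereo big1 ?add0r// => i _.
by rewrite (is_partial_dmap (is_partial_cst _ _ _)) scaler0.
Qed.

(** The three terms come from differentiating the factor [- 2 * weight], from differentiating the
    bracket of [christ], and from the Christoffel symbols. *)
Lemma nabla_christ p v w y :
  nabla h (fun=> p) (fun z => christ z v w) y =
  (2 * weight y) ^+ 2 * dot y p *: (dot y v *: w + dot y w *: v - dot v w *: y)
  - (2 * weight y) *: (dot p v *: w + dot p w *: v - dot v w *: p)
  + christ y p (christ y v w).
Proof.
rewrite nabla_stereo; congr (_ + _).
have hc i : is_partial i (fun z => christ z v w) y
   ((4 * weight y ^+ 2 * y 0 i) *: (dot y v *: w + dot y w *: v - dot v w *: y)
     - (2 * weight y) *: (v 0 i *: w + w 0 i *: v - dot v w *: delta_mx 0 i)).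
  have hid := is_partial_id i y.
  have hd x := is_derive_dot hid (is_partial_cst i x y).
  have h2 := is_derive_cst (-2 : R) y (delta_mx 0 i).
  have h3 := is_partialD (is_partialD
     (is_partialZ (hd v) (is_partial_cst i w y)) (is_partialZ (hd w) (is_partial_cst i v y)))
     (is_partialZ (is_derive_cst (- dot v w) y (delta_mx 0 i)) hid).
  apply: eq_is_partial (is_partialZ (is_deriveM h2 (is_derive_weight hid)) h3) _ _.
    by move=> z; rewrite scaleNr.
  rewrite !(dotC (delta_mx 0 i)) !dot_delta !(dotC y 0) !dot0l.
  apply/rowP => a; rewrite !mxE -![_ *: _]/(_ * _) /cst -[(_ * _) y]/(-2 * weight y).
  by ring.
pose X := dot y v *: w + dot y w *: v - dot v w *: y.
(* Each summand is arranged so that summing over [i] produces only dot products with [p] and the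
   vector [p] itself. *)
transitivity (\sum_i ((y 0 i * p 0 i) *: ((2 * weight y) ^+ 2 *: X)
   - ((p 0 i * v 0 i) *: (2 * weight y *: w) + (p 0 i * w 0 i) *: (2 * weight y *: v)
      - (2 * weight y * dot v w) *: (p 0 i *: delta_mx 0 i)))).
  apply: eq_bigr => i _; rewrite (is_partial_dmap (hc i)) -/X.
  by move: X (delta_mx 0 i) => X d; apply/rowP => a; rewrite !mxE; ring.
rewrite !sumrB big_split/= -!scaler_suml -scaler_sumr -row_sum_delta -!dotE -/X.
by move: X => X; apply/rowP => a; rewrite !mxE; ring.
Qed.

(** Constant sectional curvature [r ^- 2]: the squared conformal factor turns [dot] into the metric.
    Constant fields commute, so only the second covariant derivatives contribute. *)
Lemma curvature_stereo y p v w :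
  curvature_at h y p v w =
  (r ^- 2 * (2 * l * r * weight y) ^+ 2) *: (dot v w *: p - dot p w *: v).
Proof.
rewrite /curvature_at /curvature.
have cst_nabla a b : nabla h (fun=> a) (fun=> b) = (fun z => christ z a b).
  by apply/funext => z; rewrite nabla_cst.
rewrite !cst_nabla !nabla_christ nabla_cst.
have -> : lie_bracket (fun=> p) (fun=> v) y = 0.
  apply/rowP => k; rewrite !mxE big1// => i _.
  by rewrite /partial !derive_cst !mulr0 subrr.
rewrite /christ !dotDE dotyy !(dotC _ y) (dotC y 0) (dotC p v) !(dotC _ w).
have u0 := weight_neq0 y; have r00 : r != 0 by rewrite gt_eqF.
rewrite dot0l (dotC w 0) dot0l.
move: (weight y) u0 => u u0.
apply/rowP => a; rewrite !mxE.
by field; rewrite u0 r00.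
Qed.
End Stereographic.

(** * Smoothness by way of rational functions *)

Lemma near_eq_differentiable (R : realType) (V W : normedModType R) (f g : V -> W) x :
  (\near x, f x = g x) -> differentiable f x -> differentiable g x.
Proof.
move=> fg /diff_locallyP[cf /eqaddoP hf].
have gx : g x = f x by rewrite (nbhs_singleton fg).
have hg : g \o shift x = cst (g x) + 'd f x +o_ 0 id.
  apply/eqaddoP => e e0; have := hf e e0; rewrite gx.
  move: fg; rewrite (near_shift 0) subr0; apply: filterS2 => y /= fgy.
  by rewrite -![(_ - _) y]/(_ - _) /= fgy.
(* The first-order expansion of [f] is also one for [g], and uniqueness makes ['d f x] the
   differential of [g]. *)
by apply/diff_locallyP; rewrite (diff_unique cf hg).
Qed.

Section RationalFunctions.
Variables (R : realType) (m : nat) (U : set 'rV[R]_m).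

(* The smoothness proofs only need a class of functions stable under
   partial derivatives. *)
Inductive ratfun : ('rV[R]_m -> R) -> Prop :=
| ratfun_cst c : ratfun (fun=> c)
| ratfun_coord i : ratfun (fun x => x 0 i)
| ratfun_add f g : ratfun f -> ratfun g -> ratfun (fun x => f x + g x)
| ratfun_mul f g : ratfun f -> ratfun g -> ratfun (fun x => f x * g x)
| ratfun_inv f : ratfun f -> (forall x, U x -> f x != 0) -> ratfun (fun x => (f x)^-1)
| ratfun_ext f g : ratfun f -> (forall x, U x -> f x = g x) -> ratfun g.

Hypothesis oU : open U.

Lemma near_on (P : 'rV[R]_m -> Prop) x : U x -> (forall y, U y -> P y) -> \near x, P x.
Proof. by move=> Ux UP; apply: filterS UP _; exact: open_nbhs_nbhs. Qed.

Lemma ratfun_differentiable f x : ratfun f -> U x -> differentiable f x.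
Proof.
move=> rf; elim: rf x => {f}.
- by move=> c x _; exact: differentiable_cst.
- by move=> i x _; exact: differentiable_coord.
- by move=> f g _ hf _ hg x Ux; exact: differentiableD (hf _ Ux) (hg _ Ux).
- by move=> f g _ hf _ hg x Ux; exact: differentiableM (hf _ Ux) (hg _ Ux).
- by move=> f _ hf f0 x Ux; exact: differentiableV (hf _ Ux) (f0 _ Ux).
- move=> f g _ hf fg x Ux; apply: near_eq_differentiable (hf _ Ux).
  exact: near_on Ux fg.
Qed.

(** Each differentiation rule holds on [U] only, which suffices thanks to [ratfun_ext]; as [U] is
    open, functions that agree on it have the same derivatives there. *)
Lemma ratfun_partial f i : ratfun f -> ratfun (partial i f).
Proof.
have dvb (g : 'rV_m -> R) x : ratfun g -> U x -> derivable g x (delta_mx 0 i).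
  by move=> rg Ux; apply: diff_derivable; exact: ratfun_differentiable.
elim=> {f}.
- move=> c; apply: (@ratfun_ext (fun=> 0)) => [|x _]; first exact: ratfun_cst.
  by rewrite /partial derive_cst.
- move=> j; apply: (@ratfun_ext (fun=> delta_mx (0 : 'I_1) i 0 j)) => [|x _].
    exact: ratfun_cst.
  by have [_ <-] := is_partial_id i x j.
- move=> f g rf hf rg hg; apply: (ratfun_ext (ratfun_add hf hg)) => x Ux.
  by rewrite /partial deriveD//; exact: dvb.
- move=> f g rf hf rg hg.
  apply: (ratfun_ext (ratfun_add (ratfun_mul rf hg) (ratfun_mul rg hf))) => x Ux.
  by rewrite /partial deriveM//; exact: dvb.
- move=> f rf hf f0; have rV := ratfun_inv rf f0.
  apply: (ratfun_ext (ratfun_mul (ratfun_mul (ratfun_cst (-1)) (ratfun_mul rV rV)) hf)).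
  move=> x Ux; rewrite /partial deriveV//; [|exact: f0|exact: dvb].
  by rewrite mulN1r -[_ *: _]/(_ * _) -invfM expr2.
- move=> f g rf hf fg; apply: (ratfun_ext hf) => x Ux.
  by apply: near_eq_derive; exact: near_on Ux fg.
Qed.

Lemma ratfun_smooth f : ratfun f -> smooth_on U f.
Proof.
move=> rf s x Ux; apply: ratfun_differentiable Ux.
by elim: s => //= i s; exact: ratfun_partial.
Qed.

Lemma ratfun_sum n (f : 'I_n -> 'rV[R]_m -> R) :
  (forall i, ratfun (f i)) -> ratfun (fun x => \sum_i f i x).
Proof.
move=> rf; elim: (index_enum _) => [|i s IHs].
  by under [X in ratfun X]funext do rewrite big_nil; exact: ratfun_cst.
by under [X in ratfun X]funext do rewrite big_cons; exact: ratfun_add.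
Qed.

Definition ratmap n (F : 'rV[R]_m -> 'rV[R]_n) := forall a, ratfun (fun x => F x 0 a).

Section RationalMaps.
Variable n : nat.
Implicit Types F G : 'rV[R]_m -> 'rV[R]_n.

Lemma ratmap_ext F G : ratmap F -> (forall x, U x -> F x = G x) -> ratmap G.
Proof. by move=> rF FG a; apply: (ratfun_ext (rF a)) => x Ux; rewrite FG. Qed.

Lemma ratmap_cst (v : 'rV[R]_n) : ratmap (fun=> v).
Proof. by move=> a; exact: ratfun_cst. Qed.

Lemma ratmapD F G : ratmap F -> ratmap G -> ratmap (fun x => F x + G x).
Proof.
move=> rF rG a; under [X in ratfun X]funext do rewrite mxE.
exact: ratfun_add.
Qed.

Lemma ratmapZ u F : ratfun u -> ratmap F -> ratmap (fun x => u x *: F x).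
Proof.
move=> ru rF a; under [X in ratfun X]funext do rewrite mxE.
exact: ratfun_mul.
Qed.

Lemma ratfun_dot F G : ratmap F -> ratmap G -> ratfun (fun x => dot (F x) (G x)).
Proof.
move=> rF rG; under [X in ratfun X]funext do rewrite dotE.
by apply: ratfun_sum => i; exact: ratfun_mul.
Qed.

Lemma ratmap_mulmx p F (M : 'M[R]_(n, p)) : ratmap F -> ratmap (fun x => F x *m M).
Proof.
move=> rF a; under [X in ratfun X]funext do rewrite mxE.
by apply: ratfun_sum => i; apply: ratfun_mul => //; exact: ratfun_cst.
Qed.

Lemma ratmap_dmap F i : ratmap F -> ratmap (dmap F i).
Proof.
move=> rF a; under [X in ratfun X]funext do rewrite mxE.
exact: ratfun_partial.
Qed.

Lemma ratmap_is_partial F i x : ratmap F -> U x -> is_partial i F x (dmap F i x).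
Proof.
move=> rF Ux a; rewrite mxE; apply: derivableP; apply: diff_derivable.
exact: ratfun_differentiable (rF a) Ux.
Qed.

End RationalMaps.

Lemma ratmap_id : ratmap id.
Proof. exact: ratfun_coord. Qed.

Section RationalStereographic.
Variables (n : nat) (r l : R) (B : 'M[R]_(n + 1)) (l0 : 0 < l).
Variable F : 'rV[R]_m -> 'rV[R]_n.
Hypothesis rF : ratmap F.

Lemma ratfun_weight : ratfun (fun x => weight l (F x)).
Proof.
apply: ratfun_inv => [|x _]; last by have := weight_neq0 l0 (F x); rewrite invr_eq0.
apply: ratfun_add; first exact: ratfun_cst.
under [X in ratfun X]funext do rewrite normsqE.
exact: ratfun_dot.
Qed.

Lemma ratmap_param : ratmap (fun x => param (stereo r l B) (F x)).
Proof.
under [X in ratmap X]funext do rewrite paramE// rayE.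
apply: ratmapD; first exact: ratmap_cst.
apply: ratmapZ; first by apply: ratfun_mul; [exact: ratfun_cst|exact: ratfun_weight].
by apply: ratmapD; [exact: ratmap_mulmx|exact: ratmap_cst].
Qed.

(** By conformality the transpose of [jac] inverts it up to a scalar, so this recovers a rational
    field in the chart from its ambient image. *)
Lemma ratmap_mul_trjac G : ratmap G ->
  ratmap (fun x => G x *m (jac r l B (F x))^T).
Proof.
move=> rG; have rw := ratfun_weight.
apply: (@ratmap_ext _ (fun x => (2 * l * r * weight l (F x)) *:
   (G x *m (usubmx B)^T + (- 1 * (2 * weight l (F x) * dot (G x) (ray l B (F x)))) *: F x))).
  apply: ratmapZ; first by apply: ratfun_mul => //; exact: ratfun_cst.
  apply: ratmapD; first exact: ratmap_mulmx.
  apply: ratmapZ => //; apply: ratfun_mul; first exact: ratfun_cst.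
  apply: ratfun_mul; first by apply: ratfun_mul => //; exact: ratfun_cst.
  apply: ratfun_dot => //; under [X in ratmap X]funext do rewrite rayE.
  by apply: ratmapD; [exact: ratmap_mulmx|exact: ratmap_cst].
move=> x _; rewrite /jac linearZ -scalemxAr; congr (_ *: _).
rewrite linearB linearZ/= trmx_mul trmxK mulmxBr -scalemxAr mulmxA dot_mx.
by rewrite mul_scalar_mx scalerA mulN1r scaleNr.
Qed.

End RationalStereographic.
End RationalFunctions.

(** * Inverse charts and covariant derivatives along maps into a sphere *)

Lemma mul_tr_dot (R : comPzRingType) n p (X : 'rV[R]_p) (M : 'M[R]_(n, p)) a :
  (X *m M^T) 0 a = dot X (delta_mx 0 a *m M).
Proof. by rewrite -rowE dotE mxE; apply: eq_bigr => i _; rewrite !mxE. Qed.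

Section StereographicTheory.
Variables (R : realType) (n : nat) (r l : R) (B : 'M[R]_(n + 1)).
Hypotheses (r0 : 0 < r) (l0 : 0 < l) (hB : orthogonal_mx B).
Implicit Types (y v : 'rV[R]_n).

Local Notation Phi := (param (stereo r l B)).
Local Notation h := (chart_metric (stereo r l B)).
Local Notation J := (jac r l B).

Lemma stereo_coordK p : chart_dom (stereo r l B) p ->
  Phi (Defs.coord (stereo r l B) p) = p.
Proof.
move=> [sp]; rewrite [Phi _]/=; set q := p *m B^T => qr.
have hB' : B^T *m B = 1%:M by exact: mulmx1C.
have pE : p = q *m B by rewrite /q -mulmxA hB' mulmx1.
have dotq : dot (lsubmx q) (lsubmx q) = r ^+ 2 - rsubmx q 0 0 ^+ 2.
  have : dot q q = r ^+ 2.
    rewrite -sp normsqE (@dot_mulmx _ _ _ _ _ _ 1) ?mul1r//.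
    by rewrite trmxK hB'.
  rewrite -{1 2}(hsubmxK q) dot_row_mx => <-.
  by rewrite [dot (rsubmx q) _]dotE big_ord1 expr2 addrK.
rewrite normsqE !dotDE dotq [RHS]pE scalemxAl; congr (_ *m B).
rewrite -[RHS]hsubmxK [rsubmx q in RHS]mx11_scalar.
move: (lsubmx q) (rsubmx q 0 0) qr => v t tr.
have rt0 : r - t != 0 by rewrite subr_eq0 eq_sym.
have l00 : l != 0 by rewrite gt_eqF.
have r00 : r != 0 by rewrite gt_eqF.
(* The denominator [l ^+ 2 + normsq y] of [param] at the projected point [y], where [t] is the
   coordinate along the pole and [v] has squared length [r ^+ 2 - t ^+ 2]. *)
have e : l ^+ 2 + l / (r - t) * (l / (r - t) * (r ^+ 2 - t ^+ 2))
  = 2 * r * l ^+ 2 / (r - t) by field.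
rewrite scale_row_mx e; congr row_mx.
  by apply/rowP => a; rewrite !mxE; field; rewrite l00 r00 rt0.
by rewrite scale_scalar_mx; congr (_%:M); field; rewrite l00 r00 rt0.
Qed.

Lemma sphere_param y : sphere n r (Phi y).
Proof. by rewrite /sphere /= normsqE dot_param. Qed.

Lemma mul_jac_tr v y : v *m J y *m (J y)^T = (2 * l * r * weight l y) ^+ 2 *: v.
Proof.
by apply/rowP => a; rewrite mul_tr_dot dot_jac// dot_delta mxE.
Qed.

Lemma sum_christoffel i j y :
  \sum_k christoffel h k i j y *: delta_mx 0 k
  = christ l y (delta_mx 0 i) (delta_mx 0 j).
Proof.
rewrite -(christoffel_christ r0 l0 hB) [RHS]row_sum_delta; apply: eq_bigr => k _.
congr (_ *: _); rewrite mxE (bigD1 i)//= (bigD1 j)//= !big1 ?addr0.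
- by rewrite !mxE !eqxx !mulr1.
- by move=> a /negbTE ai; rewrite big1// => b _; rewrite !mxE ai mulr0 mul0r.
- by move=> a /negbTE aj; rewrite !mxE aj mulr0.
Qed.

Section AlongMap.
Variables (m : nat) (f : 'rV[R]_m -> 'rV[R]_n).

Lemma nabla_along_stereo i V x :
  nabla_along h f i V x = dmap V i x + christ l (f x) (dmap f i x) (V x).
Proof.
by apply/rowP => a; rewrite -(christoffel_christ r0 l0 hB) !mxE.
Qed.

(** Agreement near [x] is enough for a derivative at [x]; the proportionality to which this is
    applied is known only on an open set. *)
Lemma nabla_along_scale i (k : R) (V W : 'rV[R]_m -> 'rV[R]_n) dW x :
  (\near x, W x = k *: V x) -> is_partial i V x dW ->
  nabla_along h f i W x = k *: nabla_along h f i V x.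
Proof.
move=> WV hV; rewrite !nabla_along_stereo (nbhs_singleton WV) scalerDr.
rewrite (near_eq_dmap _ WV) (is_partial_dmap hV).
have := is_partialZ (is_derive_cst k x (delta_mx 0 i)) hV.
move=> /is_partial_dmap ->; rewrite scale0r add0r; congr (_ + _).
rewrite /christ !dotDE; move: (f x) (V x) (dmap f i x) => y v w.
by apply/rowP => a; rewrite !mxE; ring.
Qed.

(** The Gauss formula solved for the covariant derivative: adding back the component along the
    position vector leaves the tangential part of the flat derivative. *)
Lemma nabla_along_jac i (V : 'rV[R]_m -> 'rV[R]_n) x df dV :
  is_partial i f x df -> is_partial i V x dV ->
  nabla_along h f i V x *m J (f x) =
  dmap (fun z => V z *m J (f z)) i x
  + (r ^- 2 * dot (df *m J (f x)) (V x *m J (f x))) *: Phi (f x).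
Proof.
move=> hf hV; rewrite nabla_along_stereo (is_partial_dmap hf) (is_partial_dmap hV).
by rewrite (is_partial_dmap (is_partial_mul_jac r0 l0 hB hf hV)) subrK.
Qed.

End AlongMap.
End StereographicTheory.

(** * The small sphere in an arbitrary pair of charts *)

Section SmallSphere.
Variables (R : realType) (A : 'M[R]_(3 + 1)).
Hypothesis hA : orthogonal_mx A.

Local Notation r := ((Num.sqrt 2)^-1 : R).

Lemma radius_gt0 : 0 < r.
Proof. by rewrite invr_gt0 sqrtr_gt0. Qed.

Lemma radius_sq : r ^+ 2 = 2^-1.
Proof. by rewrite exprVn sqr_sqrtr. Qed.

Lemma small_sphereE p : small_sphere A p = p *m usubmx A + r *: dsubmx A.
Proof. by rewrite /small_sphere -{1}(vsubmxK A) mul_row_col mul_scalar_mx. Qed.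

Lemma small_sphere_sphere p : sphere 2 r p -> sphere 3 1 (small_sphere A p).
Proof.
rewrite /sphere/= !normsqE small_sphereE dot_frame// => ->.
by rewrite -expr2 radius_sq expr1n; field.
Qed.

Variables (lc ld : R) (Bc : 'M[R]_(2 + 1)) (Bd : 'M[R]_(3 + 1)).
Hypotheses (lc0 : 0 < lc) (ld0 : 0 < ld).
Hypotheses (hBc : orthogonal_mx Bc) (hBd : orthogonal_mx Bd).

Local Notation c := (stereo r lc Bc).
Local Notation d := (stereo 1 ld Bd).
Local Notation g := (chart_metric c).
Local Notation h := (chart_metric d).
Local Notation f := (local_expr (small_sphere A) c d).
Local Notation P := (param c).
Local Notation Phi := (param d).
Local Notation phi := (fun x => small_sphere A (param c x)).
Local Notation Jc := (jac r lc Bc).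
Local Notation Jd := (jac 1 ld Bd).
Local Notation Au := (usubmx A).

(** Open, and contains the domain of the local expression for every open part of the surface, so one
    computation on it serves all of them. *)
Definition off_pole : set 'rV[R]_2 := [set x | rsubmx (phi x *m Bd^T) 0 0 != 1].

Definition eta x : 'rV[R]_(3 + 1) := - P x *m Au + r *: dsubmx A.

Lemma ratmap_phi U : ratmap U phi.
Proof.
under [X in ratmap _ X]funext do rewrite small_sphereE.
apply: ratmapD; last exact: ratmap_cst.
by apply: ratmap_mulmx; apply: ratmap_param => //; exact: ratmap_id.
Qed.

Lemma ratfun_pole U : ratfun U (fun x => rsubmx (phi x *m Bd^T) 0 0).
Proof.
under [X in ratfun _ X]funext do rewrite mxE.
by apply: ratmap_mulmx; exact: ratmap_phi.
Qed.

Lemma open_off_pole : open off_pole.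
Proof.
apply: (@open_comp _ _ (fun x => rsubmx (phi x *m Bd^T) 0 0) [set t | t != 1]) => // x _.
apply: differentiable_continuous.
exact: (ratfun_differentiable openT (ratfun_pole setT) I).
Qed.

Lemma ratmap_local : ratmap off_pole f.
Proof.
apply: ratmapZ.
  apply: ratfun_mul; first exact: ratfun_cst.
  apply: (@ratfun_inv _ _ _ (fun x => 1 - rsubmx (phi x *m Bd^T) 0 0)).
    apply: ratfun_add; first exact: ratfun_cst.
    apply: (@ratfun_ext _ _ _ (fun x => -1 * rsubmx (phi x *m Bd^T) 0 0)).
      by apply: ratfun_mul; [exact: ratfun_cst|exact: ratfun_pole].
    by move=> x _; rewrite mulN1r.
  by move=> x; rewrite /off_pole/= subr_eq0 eq_sym.
move=> a; under [X in ratfun _ X]funext do rewrite mxE.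
by apply: ratmap_mulmx; exact: ratmap_phi.
Qed.

(** Links the chart expression [f] to the ambient map [phi], which is affine in [P] and therefore
    easy to differentiate. *)
Lemma param_local x : off_pole x -> Phi (f x) = phi x.
Proof.
move=> Ux; apply: stereo_coordK => //; split=> //.
by apply: small_sphere_sphere; apply: sphere_param => //; exact: radius_gt0.
Qed.

Local Notation conf := (fun x : 'rV[R]_2 => (2 * lc * r * weight lc x) ^+ 2).

Lemma conf_neq0 x : conf x != 0.
Proof.
by rewrite sqrf_eq0 !mulf_neq0 ?weight_neq0 ?pnatr_eq0 ?gt_eqF ?radius_gt0.
Qed.

Lemma source_metric x : g x = (conf x)%:M.
Proof. by rewrite chart_metricE. Qed.

(** Covers both [phi] ([k = 1]) and the normal [eta] ([k = -1]). *)
Lemma is_partial_affine i (F : 'rV[R]_2 -> 'rV[R]_3) dF (k : R) x :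
  is_partial i F x dF ->
  is_partial i (fun z => k *: (F z *m Au) + r *: dsubmx A) x (k *: (dF *m Au)).
Proof.
move=> hF; have hk := is_derive_cst k x (delta_mx 0 i).
apply: eq_is_partial (is_partialD (is_partialZ hk (is_partial_mulmx Au hF))
  (is_partial_cst i (r *: dsubmx A) x)) _ _ => //.
by rewrite scale0r add0r addr0.
Qed.

Lemma near_off_pole (Q : 'rV[R]_2 -> Prop) x :
  off_pole x -> (forall y, off_pole y -> Q y) -> \near x, Q x.
Proof. by move=> Ux; apply: near_on Ux; exact: open_off_pole. Qed.

Lemma is_partial_local i x : off_pole x -> is_partial i f x (dmap f i x).
Proof. exact: (ratmap_is_partial open_off_pole i ratmap_local). Qed.

(** The chain rule for [Phi (f x) = phi x], which holds in a neighbourhood of [x]. *)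
Lemma dmap_jac i x : off_pole x ->
  dmap f i x *m Jd (f x) = delta_mx 0 i *m Jc x *m Au.
Proof.
move=> Ux.
rewrite -(is_partial_dmap (is_partial_param 1 Bd ld0 (is_partial_local i Ux))).
rewrite (@near_eq_dmap _ _ _ _ _ phi); last exact: near_off_pole Ux param_local.
apply: is_partial_dmap.
have := is_partial_affine 1 (is_partial_param r Bc lc0 (is_partial_id i x)).
move=> /eq_is_partial; apply; last by rewrite scale1r.
by move=> z; rewrite scale1r small_sphereE.
Qed.

Section OffPole.
Variable x : 'rV[R]_2.
Hypothesis Ux : off_pole x.

Lemma dot_dmap_jac i j :
  dot (dmap f i x *m Jd (f x)) (dmap f j x *m Jd (f x)) = conf x *+ (i == j).
Proof.
transitivity (dot (delta_mx 0 i *m Jc x *m Au) (delta_mx 0 j *m Jc x *m Au)).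
  by congr dot; exact: dmap_jac.
rewrite (dot_usub hA) (dot_jac _ lc0 hBc) dot_delta mxE eqxx eq_sym.
by rewrite mulr_natr.
Qed.

Lemma pullback_local : pullback_metric h f x = g x.
Proof.
apply/matrixP => i j; rewrite source_metric mxE [RHS]mxE -dot_dmap_jac.
by rewrite (dot_jac _ ld0 hBd) (chart_metricE _ ld0 hBd) mul_mx_scalar -scalemxAl mxE.
Qed.

(** The Gauss formula is used twice: for the chart of [S^2(r)] to expand the second derivative of
    [phi], and for [S^3] to remove its normal component. The Christoffel terms of the surface cancel
    and only the normal [eta] is left. *)
Lemma hess_jac i j : hess_map g h f i j x *m Jd (f x) = (conf x *+ (i == j)) *: eta x.
Proof.
have rf := ratmap_local.
have hdj : is_partial i (dmap f j) x (dmap (dmap f j) i x).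
  exact: (ratmap_is_partial open_off_pole i (ratmap_dmap open_off_pole j rf) Ux).
rewrite /hess_map mulmxBl (nabla_along_jac _ _ hBd (is_partial_local i Ux) hdj)//.
have -> : dmap (fun z => dmap f j z *m Jd (f z)) i x =
    (christ lc x (delta_mx 0 i) (delta_mx 0 j) *m Jc x
     - (r ^- 2 * dot (delta_mx 0 i *m Jc x) (delta_mx 0 j *m Jc x)) *: P x) *m Au.
  rewrite (@near_eq_dmap _ _ _ _ _ (fun z => delta_mx 0 j *m Jc z *m Au)); last first.
    by apply: near_off_pole Ux _ => z; exact: dmap_jac.
  apply: is_partial_dmap; apply: is_partial_mulmx.
  have := is_partial_mul_jac radius_gt0 lc0 hBc (is_partial_id i x)
    (is_partial_cst i (delta_mx 0 j) x).
  by rewrite add0r.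
rewrite dot_dmap_jac (param_local Ux).
have -> : (\sum_k christoffel g k i j x *: dmap f k x) *m Jd (f x) =
    christ lc x (delta_mx 0 i) (delta_mx 0 j) *m Jc x *m Au.
  rewrite -(sum_christoffel radius_gt0 lc0 hBc) !mulmx_suml; apply: eq_bigr => k _.
  by rewrite -!scalemxAl (dmap_jac _ Ux).
rewrite small_sphereE /eta (dot_jac _ lc0 hBc) dot_delta mxE eqxx andTb eq_sym mulr_natr.
rewrite -exprVn invrK sqr_sqrtr// expr1n invr1 mul1r !mulmxBl -(scalemxAl _ (P x)) mulNmx.
(* [N] is the Christoffel term, [- (2 * k) *: p] the correction for [S^2(r)] with [r ^- 2 = 2], and
   [k *: (p + r *: a)] the one for the unit sphere. *)
have key (p N a : 'rV[R]_(3 + 1)) k :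
    N - (2 * k) *: p + k *: (p + r *: a) - N = k *: (- p + r *: a).
  by apply/rowP => b; rewrite !mxE; ring.
exact: key.
Qed.

Lemma tension_jac : tension g h f x *m Jd (f x) = 2 *: eta x.
Proof.
have k0 := conf_neq0 x.
rewrite /tension source_metric invmx_scalar mulmx_suml.
transitivity (\sum_(i < 2) eta x); last by rewrite sumr_const card_ord scaler_nat.
apply: eq_bigr => i _; rewrite mulmx_suml (bigD1 i)//= big1 => [|j /negbTE ji].
  by rewrite addr0 -scalemxAl hess_jac eqxx scalerA mxE eqxx !mulr1n mulVf// scale1r.
by rewrite mxE eq_sym ji scale0r mul0mx.
Qed.

Lemma dot_eta v : dot (v *m Jc x *m Au) (eta x) = 0.
Proof.
rewrite /eta mulNmx dotDr dotNr dotZr (dot_usub hA) (dot_usub_dsub hA).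
by rewrite (dot_jac_param _ lc0 hBc) mulr0 oppr0 addr0.
Qed.

Lemma eta_neq0 : eta x != 0.
Proof.
have : dot (eta x) (dsubmx A) = r.
  by rewrite /eta mulNmx !dotDE (dot_usub_dsub hA) (dot_dsub hA) mulr1 oppr0 add0r.
by apply: contra_eq_neq => ->; rewrite dot0l lt_eqF// radius_gt0.
Qed.

Lemma tension_neq0 : tension g h f x != 0.
Proof.
apply: contra_neq eta_neq0 => t0; apply: (@scalerI _ _ (2 : R)); first by rewrite pnatr_eq0.
by rewrite -tension_jac t0 mul0mx scaler0.
Qed.

End OffPole.

(** The bitension differentiates [tension] again. Multiplying [tension_jac] by the transpose of [Jd]
    and dividing by the squared conformal factor gives a rational formula for it. *)
Lemma ratmap_tension : ratmap off_pole (tension g h f).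
Proof.
have rf := ratmap_local.
pose q x := 2 * ld * 1 * weight ld (f x).
have rq : ratfun off_pole q.
  by apply: ratfun_mul; [exact: ratfun_cst|exact: ratfun_weight].
apply: (@ratmap_ext _ _ _ _ (fun x => (2 * (q x * q x)^-1) *: (eta x *m (Jd (f x))^T))).
  apply: ratmapZ.
    apply: ratfun_mul; first exact: ratfun_cst.
    apply: ratfun_inv => [|x _]; first exact: ratfun_mul.
    by rewrite /q !mulf_neq0 ?weight_neq0 ?pnatr_eq0 ?oner_eq0 ?gt_eqF.
  apply: ratmap_mul_trjac => //; apply: ratmapD; last exact: ratmap_cst.
  apply: ratmap_mulmx.
  apply: (@ratmap_ext _ _ _ _ (fun x => (-1) *: P x)) => [|x _]; last by rewrite scaleN1r.
  by apply: ratmapZ; [exact: ratfun_cst|apply: ratmap_param => //; exact: ratmap_id].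
move=> x Ux; rewrite mulrC -scalerA scalemxAl -tension_jac//.
rewrite (mul_jac_tr 1 ld0 hBd) scalerA -/(q x) expr2 mulVf ?scale1r//.
by rewrite /q !mulf_neq0 ?weight_neq0 ?pnatr_eq0 ?oner_eq0 ?gt_eqF.
Qed.

(** Since [phi + eta] is constant, the flat derivative of [2 *: eta] is [-2] times that of [phi]. It
    is already tangent to [S^3]: the Gauss correction vanishes because [eta] is normal to the
    surface. *)
Lemma nabla_tension j x : off_pole x ->
  nabla_along h f j (tension g h f) x = (- 2) *: dmap f j x.
Proof.
move=> Ux; have hf := is_partial_local j Ux.
have ht := ratmap_is_partial open_off_pole j ratmap_tension Ux.
apply: (jac_inj ltr01 ld0 hBd (y := f x)).
rewrite (nabla_along_jac ltr01 ld0 hBd hf ht).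
rewrite (@near_eq_dmap _ _ _ _ _ (fun z => 2 *: eta z)); last first.
  by apply: near_off_pole Ux _ => z; exact: tension_jac.
have -> : dmap (fun z => 2 *: eta z) j x = (- 2) *: (delta_mx 0 j *m Jc x *m Au).
  apply: is_partial_dmap.
  have := is_partial_affine (-1) (is_partial_param r Bc lc0 (is_partial_id j x)).
  move=> /(is_partialZ (is_derive_cst (2 : R) x (delta_mx 0 j))) /eq_is_partial; apply.
    by move=> z; rewrite /eta scaleN1r mulNmx.
  by rewrite scale0r add0r scalerA mulrN1.
by rewrite tension_jac// dotZr -scalemxAl (dmap_jac _ Ux) dot_eta !mulr0 scale0r addr0.
Qed.

Lemma bitension_local x : off_pole x -> bitension g h f x = 0.
Proof.
move=> Ux; have oU := open_off_pole; have rf := ratmap_local.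
rewrite /bitension.
(* By [nabla_tension], the rough Laplacian of the tension field is [-2] times the trace of
   [hess_map], that is, [-2] times the tension field. *)
have -> : \sum_i \sum_j invmx (g x) i j *:
     (nabla_along h f i (nabla_along h f j (tension g h f)) x
      - \sum_(k < 2) christoffel g k i j x *: nabla_along h f k (tension g h f) x)
   = (- 2) *: tension g h f x.
  rewrite /tension scaler_sumr; apply: eq_bigr => i _.
  rewrite scaler_sumr; apply: eq_bigr => j _.
  rewrite scalerA mulrC -scalerA; congr (_ *: _); rewrite /hess_map scalerBr.
  have hdj := ratmap_is_partial oU i (ratmap_dmap oU j rf) Ux.
  congr (_ - _).
    exact: (nabla_along_scale ltr01 ld0 hBd _ (near_off_pole Ux (nabla_tension j)) hdj).
  rewrite scaler_sumr; apply: eq_bigr => k _.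
  by rewrite (nabla_tension _ Ux) !scalerA mulrC.
rewrite source_metric invmx_scalar.
have k0 := conf_neq0 x.
(* With curvature 1 and the tension field orthogonal to the surface, [R(d_i f, tau) d_i f] reduces
   to [- conf x *: tau], and the inverse metric removes [conf x]. *)
have -> : \sum_(i < 2) \sum_(j < 2) ((conf x)^-1)%:M i j *:
    curvature_at h (f x) (dmap f i x) (tension g h f x) (dmap f j x)
  = \sum_(i < 2) - tension g h f x.
  apply: eq_bigr => i _; rewrite (bigD1 i)//= big1 => [|j /negbTE ji]; last first.
    by rewrite mxE eq_sym ji scale0r.
  rewrite addr0 mxE eqxx mulr1n (curvature_stereo ltr01 ld0 hBd).
  have cw v w : 1 ^- 2 * (2 * ld * 1 * weight ld (f x)) ^+ 2 * dot v w
      = dot (v *m Jd (f x)) (w *m Jd (f x)).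
    by rewrite (dot_jac 1 ld0 hBd) expr1n invr1 mul1r.
  rewrite scalerBr !(scalerA (1 ^- 2 * _)) !cw (dot_dmap_jac Ux) tension_jac//.
  rewrite dotZl dotC (dmap_jac _ Ux) dot_eta !mulr0 scale0r sub0r scalerN scalerA.
  by rewrite eqxx mulr1n mulVf// scale1r.
by rewrite sumr_const card_ord mulNrn scaleNr scaler_nat opprK addNr.
Qed.

End SmallSphere.

(** * Orthogonal frames, and the passage from charts to atlases *)

Lemma orthogonal_dot (R : realType) n (M : 'M[R]_n) :
  (forall v w, dot (v *m M) (w *m M) = dot v w) -> orthogonal_mx M.
Proof.
move=> MM; apply/matrixP => i j.
have -> : (M *m M^T) i j = row i (M *m M^T) 0 j by rewrite [RHS]mxE.
by rewrite row_mul mul_tr_dot rowE MM dot_delta !mxE eqxx eq_sym.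
Qed.

(** Any point misses one of two antipodal poles, those of the frames [1%:M] and [- 1%:M]. The frame
    does not depend on [l], which can be chosen afterwards. *)
Lemma stereo_cover (R : realType) n (r : R) (p : 'rV[R]_(n + 1)) :
  0 < r -> sphere n r p ->
  exists2 B, orthogonal_mx B & forall l, chart_dom (stereo r l B) p.
Proof.
move=> r0 sp; have [pr|pr] := eqVneq (rsubmx p 0 0) r.
  exists (- 1%:M) => [|l].
    by rewrite /orthogonal_mx linearN/= trmx1 mulNmx mul1mx opprK.
  split=> //; rewrite linearN/= trmx1 mulmxN mulmx1 linearN/= mxE pr.
  by rewrite lt_eqF// (lt_trans _ r0)// oppr_lt0.
exists 1%:M => [|l]; first by rewrite /orthogonal_mx trmx1 mulmx1.
by split=> //; rewrite trmx1 mulmx1.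
Qed.

Section SmallSphereTheorem.
Variables (R : realType) (A : 'M[R]_(3 + 1)).
Hypothesis hA : orthogonal_mx A.
Local Notation r := ((Num.sqrt 2)^-1 : R).

Section OpenPart.
Variable W : set 'rV[R]_(2 + 1).
Local Notation SW := (W `&` sphere 2 r).

Lemma local_dom_off_pole lc ld Bc Bd x :
  local_dom SW (small_sphere A) (stereo r lc Bc) (stereo 1 ld Bd) x ->
  off_pole A lc Bc Bd x.
Proof. by case=> _ []. Qed.

Lemma smooth_small_sphere :
  smooth_map (sphere_atlas 2 r) (sphere_atlas 3 1) SW (small_sphere A).
Proof.
split=> [p [_ sp]|_ _ [lc [Bc [lc0 hBc ->]]] [ld [Bd [ld0 hBd ->]]] k s x].
  have [B hB Bp] := stereo_cover ltr01 (small_sphere_sphere hA sp).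
  by exists (stereo 1 1 B) => //; exists 1, B.
move=> /local_dom_off_pole Ux; have rf := @ratmap_local _ A lc ld Bc Bd lc0 k.
exact: (ratfun_smooth (open_off_pole lc0) rf s Ux).
Qed.

Lemma isometric_small_sphere :
  isometric_immersion (sphere_atlas 2 r) (sphere_atlas 3 1) SW (small_sphere A).
Proof.
split; first exact: smooth_small_sphere.
move=> _ _ [lc [Bc [lc0 hBc ->]]] [ld [Bd [ld0 hBd ->]]] x /local_dom_off_pole.
exact: pullback_local.
Qed.

Lemma biharmonic_small_sphere :
  biharmonic (sphere_atlas 2 r) (sphere_atlas 3 1) SW (small_sphere A).
Proof.
split; first exact: smooth_small_sphere.
move=> _ _ [lc [Bc [lc0 hBc ->]]] [ld [Bd [ld0 hBd ->]]] x /local_dom_off_pole.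
exact: bitension_local.
Qed.

(** A point of the open part is needed, together with charts around it and around its image: there
    the tension field does not vanish. *)
Lemma not_harmonic_small_sphere : SW !=set0 ->
  ~ Defs.harmonic (sphere_atlas 2 r) (sphere_atlas 3 1) SW (small_sphere A).
Proof.
move=> [p [Wp sp]] [_ harm].
have [Bc hBc pc] := stereo_cover (radius_gt0 R) sp.
have [Bd hBd pd] := stereo_cover ltr01 (small_sphere_sphere hA sp).
have pK := stereo_coordK (radius_gt0 R) ltr01 hBc (pc 1).
have Dx : local_dom SW (small_sphere A) (stereo r 1 Bc) (stereo 1 1 Bd)
    (Defs.coord (stereo r 1 Bc) p).
  by split; rewrite pK.
have := harm (stereo r 1 Bc) (stereo 1 1 Bd) _ _ _ Dx.
have cM : sphere_atlas 2 r (stereo r 1 Bc) by exists 1, Bc.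
have dN : sphere_atlas 3 1 (stereo 1 1 Bd) by exists 1, Bd.
move=> /(_ cM dN); apply/eqP.
exact: (tension_neq0 hA ltr01 ltr01 hBc hBd (local_dom_off_pole Dx)).
Qed.

End OpenPart.

(** * The local expression of the inclusion *)

Section LocalExpression.
Variable B : 'M[R]_(2 + 1).
Hypothesis hB : orthogonal_mx B.

Let Bu := usubmx B *m usubmx A.
Let e := dsubmx B *m usubmx A.
Let a := dsubmx A.

(* The frame [diag(B, 1) A] with its last two rows rotated by 45 degrees, so that
   the image of the pole of [S^2(r)] becomes the pole of [S^3]. *)
Definition adapted_frame : 'M[R]_(3 + 1) :=
  col_mx (col_mx Bu (r *: (a - e)) : 'M[R]_(2 + 1, 3 + 1)) (r *: (a + e)).

(** Brings the product to the shape to which [dot_frame] applies, first for [A] and then for [B]. *)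
Lemma mul_adapted_frame (v : 'rV[R]_2) (s t : R) :
  row_mx (row_mx v s%:M : 'rV_(2 + 1)) t%:M *m adapted_frame
  = (v *m usubmx B + (r * (t - s)) *: dsubmx B) *m usubmx A + (r * (s + t)) *: a.
Proof.
rewrite !mul_row_col !mul_scalar_mx mulmxDl -mulmxA -scalemxAl -/Bu -/e.
by move: (v *m Bu) => w; apply/rowP => b; rewrite !mxE; ring.
Qed.

Lemma adapted_frame_orthogonal : orthogonal_mx adapted_frame.
Proof.
apply: orthogonal_dot => v w.
have split3 (u : 'rV[R]_(3 + 1)) : exists q s t,
    u = row_mx (row_mx q s%:M : 'rV_(2 + 1)) t%:M.
  exists (lsubmx (lsubmx u : 'rV_(2 + 1))), (rsubmx (lsubmx u : 'rV_(2 + 1)) 0 0).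
  by exists (rsubmx u 0 0); rewrite -!mx11_scalar !hsubmxK.
have [q [s [t ->]]] := split3 v; have [q' [s' [t' ->]]] := split3 w.
rewrite !mul_adapted_frame (dot_frame hA) (dot_frame hB) dot_row_mx
  (@dot_row_mx _ 2 1) !dot_scalar.
(* The mixed products of [s] and [t] cancel as in a rotation by 45 degrees, and [2 * r ^+ 2 = 1]. *)
transitivity (dot q q' + 2 * r ^+ 2 * (s * s' + t * t')); first by ring.
by rewrite radius_sq; field.
Qed.

(** Both projections start from the point [r *: (a + e)]. As [Num.sqrt 2] is [2 * r], the first one
    is onto the tangent plane at the antipode, which [A] carries to the plane of third coordinate 1
    in the equatorial hyperplane of the second. The rays from the pole therefore coincide. *)
Lemma small_sphere_param x :
  small_sphere A (param (stereo r (Num.sqrt 2) B) x)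
  = param (stereo 1 1 adapted_frame) (row_mx x 1%:M).
Proof.
rewrite small_sphereE /= (@scale_row_mx _ 1 2 1) scale_scalar_mx mul_adapted_frame.
have -> : normsq (row_mx x 1%:M : 'rV[R]_3) = normsq x + 1.
  by rewrite !normsqE (@dot_row_mx _ 2 1) dot_scalar mulr1.
rewrite !mulr1 expr1n.
rewrite -[in LHS](vsubmxK B) mul_row_col mul_scalar_mx.
rewrite !mulmxDl -!scalemxAl !mulmxDl -!scalemxAl -/Bu -/e.
rewrite sqr_sqrtr//.
have s0 : Num.sqrt 2 != 0 :> R by rewrite gt_eqF// sqrtr_gt0.
have q0 : 2 + normsq x != 0 by rewrite gt_eqF// ltr_pwDl// normsq_ge0.
move: (x *m usubmx B *m usubmx A) (Num.sqrt 2) (normsq x) s0 q0 => w k q s0 q0.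
apply/rowP => b; rewrite !mxE; field.
by rewrite s0 (_ : 1 + (q + 1) = 2 + q) //; ring.
Qed.

End LocalExpression.

End SmallSphereTheorem.

Theorem proposition2p7 (R : realType) (A : 'M[R]_(3 + 1)) (hA : orthogonal_mx A) :
  let r := (Num.sqrt 2)^-1 : R in
  (forall W : set 'rV[R]_(2 + 1), open W -> W `&` sphere 2 r !=set0 ->
     isometric_immersion (sphere_atlas 2 r) (sphere_atlas 3 1)
       (W `&` sphere 2 r) (small_sphere A) /\
     proper_biharmonic (sphere_atlas 2 r) (sphere_atlas 3 1)
       (W `&` sphere 2 r) (small_sphere A)) /\
  (forall p, sphere 2 r p ->
     exists c d, [/\ sphere_atlas 2 r c /\ sphere_atlas 3 1 d,
       chart_dom c p,
       forall x : 'rV[R]_2, chart_metric c x = (4 / (2 + normsq x) ^+ 2)%:M,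
       forall y : 'rV[R]_3, chart_metric d y = (4 / (1 + normsq y) ^+ 2)%:M &
       forall x : 'rV[R]_2,
         small_sphere A (param c x) = param d (row_mx x 1%:M)]).
Proof.
move=> r; split=> [W _ W0|p sp].
  split; first exact: isometric_small_sphere.
  by split; [exact: biharmonic_small_sphere|exact: not_harmonic_small_sphere].
have [B hB Bp] := stereo_cover (radius_gt0 R) sp.
have s2 : 0 < Num.sqrt 2 :> R by rewrite sqrtr_gt0.
have hD := adapted_frame_orthogonal hA hB.
(* With [l = Num.sqrt 2] both [l * r = 1] and [l ^+ 2 = 2] hold, which gives the prescribed source
   metric; equatorial projection [l = 1] gives the target one. *)
exists (stereo r (Num.sqrt 2) B), (stereo 1 1 (adapted_frame A B)); split=> //.
- by split; [exists (Num.sqrt 2), B|exists 1, (adapted_frame A B)].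
- move=> x; rewrite (chart_metricE _ s2 hB) /weight sqr_sqrtr// /r mulfK ?gt_eqF//.
  by rewrite exprMn exprVn -natrX.
- move=> y; rewrite (chart_metricE _ ltr01 hD) /weight expr1n !mulr1.
  by rewrite exprMn exprVn -natrX.
- exact: small_sphere_param.
Qed.
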